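(* Let $\vec{\sigma}=(\sigma_1,\sigma_2,\ldots)$ be a weighting sequence with mean $\alpha$, i.e. $\lim_{n\to\infty}\frac1n\sum_{k=1}^n\sigma_k=\alpha$. For $0<x<1$ consider the $\vec{\sigma}$-weighted Boltzmann measure $\mathbb{P}_{\vec{\sigma},x}$ on permutations, let $N$ be the size of the ground set of a random permutation, and let $x=x(\mu)$ be chosen so that $\mathbb{E}_{\vec{\sigma},x}(N)=\mu$. Let $X$ be the number of cycles of the random permutation. Then $\mathbb{E}_{\vec{\sigma},x}(X)=\mathbb{V}_{\vec{\sigma},x}(X)\sim\alpha\log\mu$ as $x\to1^-$ or $\mu\to\infty$.
   Context: A weighting sequence is a sequence $\vec{\sigma}=(\sigma_1,\sigma_2,\ldots)$ of nonnegative reals; the weight of $\pi\in S_n$ is $w_{\vec{\sigma}}(\pi)=\prod_i\sigma_i^{c_i(\pi)}$ with $c_i(\pi)$ the number of $i$-cycles of $\pi$. The $\vec{\sigma}$-weighted Boltzmann measure with parameter $x>0$ is the probability measure on $\bigcup_{k\ge0}S_k$ given by \[ \mathbb{P}_{\vec{\sigma},x}(\pi)=\frac{w_{\vec{\sigma}}(\pi)\,x^{|\pi|}/|\pi|!}{\exp\left(\sum_{k\ge1}\sigma_kx^k/k\right)}, \] where $|\pi|$ is the size of the ground set of $\pi$; $\mathbb{E}_{\vec{\sigma},x}$ and $\mathbb{V}_{\vec{\sigma},x}$ are expectation and variance under it.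
   Formalization: The mean α is assumed positive; for α = 0 the relation ∼ α log μ has no meaning and fails, e.g. for σ = (1,0,0,…), where the expected number of cycles and the expected size both equal x. *)

(* Defs.v *)
From HB Require Import structures.
From mathcomp Require Import all_boot all_order all_algebra all_fingroup.
From mathcomp Require Import all_classical all_reals all_analysis.
Set Implicit Arguments. Unset Strict Implicit. Unset Printing Implicit Defensive.
Import Order.TTheory GRing.Theory Num.Theory.
Import numFieldNormedType.Exports.
Local Open Scope ring_scope.

Section Boltzmann.
Variable R : realType.

Definition cyc_count (n : nat) (s : 'S_n) (i : nat) : nat :=
  #|[set C in porbits s | #|C| == i]|.

(* w_sigma(pi) = prod_i sigma_i ^ c_i(pi)  (only i in 1..n can have c_i > 0;
   sigma 0 is never used) *)
Definition weight (sigma : nat -> R) (n : nat) (s : 'S_n) : R :=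
  \prod_(1 <= i < n.+1) sigma i ^+ cyc_count s i.

Definition boltz_Z (sigma : nat -> R) (x : R) : R :=
  expR (limn (fun N => \sum_(1 <= k < N) sigma k * x ^+ k / k%:R)).

Definition boltz_P (sigma : nat -> R) (x : R) (n : nat) (s : 'S_n) : R :=
  weight sigma s * x ^+ n / (n`!)%:R / boltz_Z sigma x.

Definition perm_rv := forall n : nat, 'S_n -> R.

Definition boltz_E (sigma : nat -> R) (x : R) (f : perm_rv) : R :=
  limn (fun M => \sum_(0 <= n < M) \sum_(s : 'S_n) f n s * boltz_P sigma x s).

Definition boltz_V (sigma : nat -> R) (x : R) (f : perm_rv) : R :=
  boltz_E sigma x (fun n s => (f n s - boltz_E sigma x f) ^+ 2).

Definition rv_size : perm_rv := fun n _ => n%:R.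

Definition rv_ncycles : perm_rv := fun n s => (#|porbits s|)%:R.

End Boltzmann.

(* Main.v *)
(* Write [a k = sigma k * x ^+ k / k] and [S = \sum_k a k].  Deleting the
   successor of a marked point from its cycle yields a recursion for sums over
   permutations, hence the exponential formula: the number of cycles [X] is a
   Poisson variable with parameter [S], so [E(X) = V(X) = S], and the same
   recursion gives [E(N) = \sum_k sigma k * x ^+ k].  Abel summation compares
   both series with those of the constant sequence [alpha], namely
   [alpha * - ln (1 - x)] and [alpha * x / (1 - x)]; hence
   [E(X) ~ alpha * - ln (1 - x)] and [ln E(N) ~ - ln (1 - x)] at [1]. *)
Require Import Defs.
From HB Require Import structures.
From mathcomp Require Import all_boot all_order all_algebra all_fingroup.
Set Implicit Arguments. Unset Strict Implicit. Unset Printing Implicit Defensive.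
Import Order.TTheory GRing.Theory Num.Theory.
Local Open Scope ring_scope.

(** * Effect of a transposition on the cycles of a permutation *)

Section PeelingCycles.
Variable T : finType.
Implicit Types (s : {perm T}) (A C : {set T}) (x y z : T).

Lemma porbit_subset s A z :
  z \in A -> (forall y, y \in A -> s y \in A) -> porbit s z \subset A.
Proof.
move=> zA sA; apply/subsetP=> _ /porbitP[i ->].
by elim: i => [|i IHi]; rewrite ?expg0 ?perm1 // expgSr permM sA.
Qed.

Lemma porbit_stable s z y : (s y \in porbit s z) = (y \in porbit s z).
Proof. by have := porbit_perm s 1 y; rewrite expg1 -!eq_porbit_mem => ->. Qed.

Lemma porbit_fix s z : s z = z -> porbit s z = [set z].
Proof.
move=> sz; apply/eqP; rewrite eqEsubset sub1set porbit_id andbT.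
by apply: porbit_subset; rewrite ?set11 // => y /set1P->; rewrite sz set11.
Qed.

Lemma porbit_tperm_out s x y z : x \notin porbit s z -> y \notin porbit s z ->
  porbit (tperm x y * s) z = porbit s z.
Proof.
move=> xNs yNs.
have E i : ((tperm x y * s) ^+ i)%g z = (s ^+ i)%g z.
  elim: i => [|i IHi]; first by rewrite !expg0.
  rewrite !expgSr !permM IHi tpermD //.
    by apply: contraNneq xNs => ->; rewrite mem_porbit.
  by apply: contraNneq yNs => ->; rewrite mem_porbit.
apply/setP=> t; apply/porbitP/porbitP=> -[i ->]; exists i; by rewrite E.
Qed.

(** The product [tperm x y * s] sends [x] to [y] and [y] to [s x]: it inserts the fixed point [y]
    into the cycle of [x], right after [x]. *)
Lemma porbit_tperm_in s x y : x != y -> s y = y ->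
  porbit (tperm x y * s) x = y |: porbit s x.
Proof.
move=> xy sy; set t := (_ * _)%g.
have tx : t x = y by rewrite permM tpermL.
have ty : t y = s x by rewrite permM tpermR.
have yt : y \in porbit t x by rewrite -tx porbit_stable porbit_id.
apply/eqP; rewrite eqEsubset; apply/andP; split.
  apply: porbit_subset; first by rewrite !inE porbit_id orbT.
  move=> z; case: (eqVneq z x) => [->|zx]; first by rewrite tx setU11.
  case: (eqVneq z y) => [->|zy] /[!inE]; first by rewrite ty porbit_stable porbit_id orbT.
  by rewrite (negPf zy) /= permM tpermD 1?eq_sym // porbit_stable => ->; rewrite orbT.
rewrite subUset sub1set yt; apply: porbit_subset; first exact: porbit_id.
move=> z zt; case: (eqVneq z x) => [->|zx].
  by rewrite -ty porbit_stable.
case: (eqVneq z y) => [->|zy]; first by rewrite sy.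
have -> : s z = t z by rewrite permM tpermD 1?eq_sym.
by rewrite porbit_stable.
Qed.

Lemma card_porbit_tperm s x y : x != y -> s y = y ->
  #|porbit (tperm x y * s) x| = #|porbit s x|.+1.
Proof.
move=> xy sy; rewrite porbit_tperm_in // cardsU1 porbit_sym porbit_fix //.
by rewrite inE xy.
Qed.

(** A permutation supported on [A] still has the points outside [A] as singleton orbits; these are
    discarded here, so that points can be removed from [A] without changing the type [T]. *)
Definition cycles_in s A := [set C in porbits s | C \subset A].

Lemma porbit_sub_on s A x : perm_on A s -> x \in A -> porbit s x \subset A.
Proof. by move=> As xA; apply: porbit_subset => // y; rewrite perm_closed. Qed.

Lemma cycles_inD1 s A x : perm_on A s -> x \in A ->
  cycles_in s A = porbit s x |: cycles_in s (A :\ x).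
Proof.
move=> As xA; apply/setP=> C; rewrite !inE.
apply/idP/idP.
  case/andP=> /imsetP[z _ ->] zA.
  case: (boolP (x \in porbit s z)) => [xz|xz].
    by rewrite eq_porbit_mem porbit_sym xz.
  by rewrite subsetD1 zA xz imset_f ?inE // orbT.
case/orP=> [/eqP->|/andP[-> ]]; first by rewrite imset_f // porbit_sub_on.
by rewrite subsetD1 => /andP[].
Qed.

Lemma porbit_notin_cycles_in s A x : porbit s x \notin cycles_in s (A :\ x).
Proof. by rewrite inE subsetD1 porbit_id !andbF. Qed.

Lemma cycles_in_tperm s A x y : x != y -> s y = y ->
  cycles_in (tperm x y * s)%g (A :\ x) = cycles_in s (A :\ y :\ x).
Proof.
move=> xy sy; apply/setP=> C; rewrite !inE !subsetD1.
apply/idP/idP; last first. 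
  case/andP=> /imsetP[z _ ->] /andP[/andP[-> yz] xz].
  by rewrite xz -(porbit_tperm_out xz yz) imset_f.
case/andP=> /imsetP[z _ ->] /andP[-> xz].
(* The composite maps [x] to [y], so an orbit that avoids [x] avoids [y] as well. *)
have yz : y \notin porbit (tperm x y * s) z.
  apply: contra xz => yz; rewrite -porbit_stable.
  by rewrite permM tpermL sy.
rewrite xz yz -(porbit_tperm_out xz yz) mulgA tperm2 mul1g imset_f //.
Qed.

Lemma perm_onD1 s A x : perm_on (A :\ x) s = perm_on A s && (s x == x).
Proof.
apply/idP/andP.
  move=> As; split; last by rewrite (out_perm As) ?setD11.
  by apply: subset_trans As _; apply: subD1set.
case=> As /eqP sx; apply/subsetP=> y ys; rewrite !inE (subsetP As) // andbT.
by apply: contraTneq ys => ->; rewrite inE sx eqxx.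
Qed.

Lemma perm_on_tperm s A x y : x \in A -> y \in A ->
  perm_on A (tperm x y * s)%g = perm_on A s.
Proof.
move=> xA yA; have tA : perm_on A (tperm x y).
  by apply/subsetP=> z; rewrite inE; case: tpermP => [->|->|_ _] //; rewrite eqxx.
apply/idP/idP => sA; last exact: perm_onM.
by rewrite -(mul1g s) -(tperm2 x y) -mulgA perm_onM.
Qed.

End PeelingCycles.

(** * Weighted sums over permutations of a set, and their recursion *)

Section CycleIndex.
Variables (R : comNzRingType) (sigma : nat -> R).

(** The test function [F] of the number of cycles is carried along so that a single recursion yields
    every moment of that number. *)
Definition cycle_weight (T : finType) (F : nat -> R) (O : {set {set T}}) : R :=
  (\prod_(C in O) sigma #|C|) * F #|O|.

Definition cycle_sum (T : finType) (A : {set T}) (F : nat -> R) : R :=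
  \sum_(s : {perm T} | perm_on A s) cycle_weight F (cycles_in s A).

(** The cycle through [x] has its own weight [tau] and is not counted by [F]. The weight is left
    free because removing a point from this cycle shifts [tau]. *)
Definition marked_cycle_sum (T : finType) (A : {set T}) (x : T)
    (tau F : nat -> R) : R :=
  \sum_(s : {perm T} | perm_on A s)
    tau #|porbit s x| * cycle_weight F (cycles_in s (A :\ x)).

Lemma cycle_sum_mark (T : finType) (A : {set T}) (x : T) (F : nat -> R) :
  x \in A -> cycle_sum A F = marked_cycle_sum A x sigma (fun j => F j.+1).
Proof.
move=> xA; apply: eq_bigr => s As.
rewrite (cycles_inD1 As xA) /cycle_weight big_setU1 ?porbit_notin_cycles_in //=.
by rewrite cardsU1 porbit_notin_cycles_in mulrA.
Qed.

(* When [y = s x] differs from [x], the permutation [tperm x y * s] fixes [y],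
   and its cycle through [x] is that of [s] with [y] removed. *)
Lemma marked_cycle_sum_peel (T : finType) (A : {set T}) (x : T)
    (tau F : nat -> R) : x \in A ->
  marked_cycle_sum A x tau F = tau 1 * cycle_sum (A :\ x) F
    + \sum_(y in A :\ x) marked_cycle_sum (A :\ y) x (fun k => tau k.+1) F.
Proof.
move=> xA; rewrite /marked_cycle_sum.
rewrite (partition_big (fun s : {perm T} => s x) (mem A)) /=; last first.
  by move=> s As; rewrite perm_closed.
rewrite (bigD1 x) //=; congr (_ + _).
  rewrite /cycle_sum mulr_sumr; apply: eq_big => [s|s /andP[As /eqP sx]].
    by rewrite perm_onD1.
  by rewrite porbit_fix // cards1.
rewrite big_mkcond [RHS]big_mkcond; apply: eq_bigr => y _.
rewrite !inE andbC; case: ifP => // /andP[yx yA].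
have xy : x != y by rewrite eq_sym.
rewrite (reindex_inj (mulgI (tperm x y))) /=.
apply: eq_big => [s|s /andP[As /eqP]].
  by rewrite perm_on_tperm // permM tpermL perm_onD1.
rewrite permM tpermL => sy.
by rewrite card_porbit_tperm // cycles_in_tperm.
Qed.

End CycleIndex.

(** * Coefficients of exponential-type expressions in a power series *)

Section ExponentialFormula.
Variable R : numFieldType.
Implicit Types (u v F : nat -> R).

Definition cauchy_prod u v (n : nat) : R := \sum_(i < n.+1) u i * v (n - i)%N.

(* The coefficients of [A ^+ j / j!], where [A] is the power series of [a]. *)
Fixpoint exp_coefs (a : nat -> R) (j n : nat) : R :=
  if j is i.+1 then cauchy_prod a (exp_coefs a i) n / j%:R else (n == 0)%:R.

(** Coefficient [n] of [\sum_j F j * A ^+ j / j!]. When [a 0 = 0], powers above [n] contribute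
    nothing, so the sum may stop at [n]. For [F = 1] the series is the exponential of [A]. *)
Definition exp_moment a F (n : nat) : R :=
  \sum_(j < n.+1) F j * exp_coefs a j n.

Variable a : nat -> R.
Hypothesis a0 : a 0 = 0.
Let c := exp_coefs a.
Let h := exp_moment a.

Lemma exp_coefs_small j n : (n < j)%N -> c j n = 0.
Proof.
elim: j n => [//|j IHj] n nj; rewrite /c /= /cauchy_prod big_ord_recl a0 mul0r add0r.
rewrite big1 ?mul0r // => i _; rewrite -/(c j _) IHj ?mulr0 //.
by rewrite lift0 ltn_subLR // addSn (leq_trans nj) // ltnS leq_addl.
Qed.

Lemma exp_coefsS j n : j.+1%:R * c j.+1 n = cauchy_prod a (c j) n.
Proof. by rewrite /c /= mulrC divfK ?pnatr_eq0. Qed.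

(** Truncating [A] at degree [N] leaves the coefficients up to [N] unchanged, which makes the
    derivative of polynomials available. *)
Lemma exp_coefs_poly N j n : (n <= N)%N ->
  c j n * j`!%:R = ((\poly_(i < N.+1) a i) ^+ j)`_n.
Proof.
elim: j n => [|j IHj] n nN; first by rewrite expr0 coef1 mulr1.
rewrite factS natrM mulrA [c _ _ * _]mulrC exp_coefsS exprS coefM /cauchy_prod mulr_suml.
apply: eq_bigr => i _; have iN : (i <= N)%N by rewrite -ltnS (leq_trans (ltn_ord i)).
by rewrite coef_poly ltnS iN -IHj ?mulrA // (leq_trans (leq_subr _ _)).
Qed.

(* The identity [(A ^+ j.+1)^`() = j.+1 * A^`() * A ^+ j], coefficientwise. *)
Lemma exp_coefs_deriv j n :
  n%:R * c j.+1 n = cauchy_prod (fun k => k%:R * a k) (c j) n.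
Proof.
case: n => [|n]; first by rewrite /cauchy_prod big_ord_recl big_ord0 !mul0r add0r.
rewrite /cauchy_prod big_ord_recl !mul0r add0r.
have jf0 k : k`!%:R != 0 :> R by rewrite pnatr_eq0 -lt0n fact_gt0.
apply: (mulIf (jf0 j.+1)); rewrite -mulrA (exp_coefs_poly j.+1 (leqnn n.+1)).
set P := \poly_(i < _) _; rewrite mulr_natl -coef_deriv deriv_exp /= coefMn coefM.
rewrite factS natrM mulrCA mulr_natl; congr (_ *+ _); rewrite mulr_suml.
apply: eq_bigr => i _; rewrite coef_deriv coef_poly ltnS.
have iN := ltn_ord i; rewrite iN -exp_coefs_poly; last first.
  by rewrite (leq_trans (leq_subr _ _)).
by rewrite -[bump 0 i]/(i.+1) subSS -[a _ *+ _]mulr_natl !mulrA.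
Qed.

Lemma exp_moment_widen F n N : (n <= N)%N ->
  h F n = \sum_(j < N.+1) F j * c j n.
Proof.
move=> nN; rewrite /h /exp_moment (big_ord_widen N.+1 (fun j => F j * c j n)) //.
rewrite big_mkcond.
apply: eq_bigr => j _; case: ltnP => // nj.
by rewrite exp_coefs_small ?mulr0.
Qed.

Lemma exp_moment_recl F n :
  h F n = F 0 * (n == 0)%:R + \sum_(j < n.+1) F j.+1 * c j.+1 n.
Proof. by rewrite (exp_moment_widen F (leqnSn n)) big_ord_recl. Qed.

Lemma cauchy_prod_exp_moment u F n :
  cauchy_prod u (h F) n = \sum_(j < n.+1) F j * cauchy_prod u (c j) n.
Proof.
transitivity (\sum_(i < n.+1) \sum_(j < n.+1) F j * (u i * c j (n - i)%N)).
  apply: eq_bigr => i _; rewrite (exp_moment_widen F (leq_subr i n)) mulr_sumr.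
  by apply: eq_bigr => j _; rewrite mulrCA.
by rewrite exchange_big; apply: eq_bigr => j _; rewrite -mulr_sumr.
Qed.

(** Multiplying coefficient [n] by [n] is a derivation; on [A ^+ j.+1 / j.+1!] it leaves the factor
    [A ^+ j / j!], whence the shift of [F]. *)
Lemma exp_moment_size F n :
  n%:R * h F n = cauchy_prod (fun k => k%:R * a k) (h (fun j => F j.+1)) n.
Proof.
rewrite exp_moment_recl cauchy_prod_exp_moment mulrDr mulr_sumr.
have -> : n%:R * (F 0 * (n == 0)%:R) = 0.
  by case: n => [|n]; rewrite ?mul0r // mulr0n !mulr0.
by rewrite add0r; apply: eq_bigr => j _; rewrite mulrCA exp_coefs_deriv.
Qed.

(** The factor [j.+1] cancels in [A ^+ j.+1 / j.+1!], leaving [A] times [A ^+ j / j!]. *)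
Lemma exp_moment_count F n :
  h (fun j => j%:R * F j) n = cauchy_prod a (h (fun j => F j.+1)) n.
Proof.
rewrite exp_moment_recl cauchy_prod_exp_moment !mul0r add0r.
by apply: eq_bigr => j _; rewrite mulrAC mulrC exp_coefsS.
Qed.

Lemma exp_coefs_scale (b : nat -> R) (x : R) j n :
  exp_coefs (fun k => b k * x ^+ k) j n = exp_coefs b j n * x ^+ n.
Proof.
elim: j n => [|j IHj] n /=; first by case: n => [|n]; rewrite ?mulr1 ?mul0r.
rewrite [RHS]mulrAC; congr (_ / _); rewrite mulr_suml; apply: eq_bigr => i _.
by rewrite IHj mulrACA -exprD subnKC // -ltnS.
Qed.

Lemma exp_moment_scale (b : nat -> R) (x : R) F n :
  exp_moment (fun k => b k * x ^+ k) F n = exp_moment b F n * x ^+ n.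
Proof.
rewrite mulr_suml; apply: eq_bigr => j _.
by rewrite exp_coefs_scale mulrA.
Qed.

End ExponentialFormula.

(** * The exponential formula for weighted cycle sums *)

Section CycleSums.
Variables (R : numFieldType) (sigma : nat -> R).
Let a k := sigma k / k%:R.

Lemma cycle_sum_set0 (T : finType) (F : nat -> R) :
  cycle_sum sigma (set0 : {set T}) F = F 0.
Proof.
have on0 (s : {perm T}) : perm_on set0 s = (s == 1%g).
  apply/idP/eqP => [s0|->]; last exact: perm_on1.
  by apply/permP=> z; rewrite perm1 (out_perm s0) ?inE.
rewrite /cycle_sum (big_pred1 (1%g : {perm T})) // /cycle_weight.
have -> : cycles_in (1%g : {perm T}) set0 = set0.
  apply/setP=> C; rewrite !inE subset0; apply/negP=> /andP[/imsetP[z _ ->]].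
  by rewrite -cards_eq0 (negPf (card_porbit_neq0 _ _)).
by rewrite big_set0 cards0 mul1r.
Qed.

(** Both formulas are proved by one induction: marking a point reduces the first to the second with
    [tau = sigma], and peeling reduces the second to both formulas on sets with one point less. *)
Lemma cycle_sum_moment_aux n :
  (forall (T : finType) (A : {set T}) F, #|A| = n ->
     cycle_sum sigma A F = n`!%:R * exp_moment a F n) /\
  (forall (T : finType) (A : {set T}) x tau F, #|A| = n.+1 -> x \in A ->
     marked_cycle_sum sigma A x tau F
     = n`!%:R * \sum_(k < n.+1) tau k.+1 * exp_moment a F (n - k)%N).
Proof.
have a0 : a 0 = 0 by rewrite /a invr0 mulr0.
elim: n => [|n [IHZ IHG]].
  have H0 (T : finType) (A : {set T}) F : #|A| = 0%N ->
      cycle_sum sigma A F = 0`!%:R * exp_moment a F 0.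
    move/eqP; rewrite cards_eq0 => /eqP->; rewrite cycle_sum_set0.
    by rewrite /exp_moment big_ord_recl big_ord0 /= addr0 mulr1 mul1r.
  split=> // T A x tau F cA xA; rewrite marked_cycle_sum_peel //.
  have A0 : #|A :\ x| = 0%N by move: cA; rewrite (cardsD1 x) xA => -[].
  rewrite H0 // big_ord_recl big_ord0 [X in _ + X]big1 ?addr0 ?mul1r // => y.
  by move/eqP: A0; rewrite cards_eq0 => /eqP->; rewrite inE.
have HZ (T : finType) (A : {set T}) F : #|A| = n.+1 ->
    cycle_sum sigma A F = (n.+1)`!%:R * exp_moment a F n.+1.
  move=> cA; have /card_gt0P[x xA] : (0 < #|A|)%N by rewrite cA.
  rewrite (cycle_sum_mark _ _ xA) (IHG _ _ _ _ _ cA xA) factS natrM mulrAC.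
  rewrite exp_moment_size // mulrC; congr (_ * _).
  (* The term [k = 0] vanishes, and [k * a k = sigma k] for positive [k]. *)
  rewrite /cauchy_prod [RHS]big_ord_recl !mul0r add0r; apply: eq_bigr => k _.
  by rewrite lift0 /a subSS mulrCA divff ?mulr1 // pnatr_eq0.
split=> // T A x tau F cA xA; rewrite marked_cycle_sum_peel //.
have cAx : #|A :\ x| = n.+1 by move: cA; rewrite (cardsD1 x) xA => -[].
rewrite HZ // (eq_bigr (fun=> n`!%:R *
    \sum_(k < n.+1) tau k.+2 * exp_moment a F (n - k)%N)); last first.
  move=> y; rewrite !inE => /andP[yx yA]; rewrite IHG //.
    by move: cA; rewrite (cardsD1 y) yA => -[].
  by rewrite !inE xA eq_sym yx.
(* The [n.+1] choices of [y] contribute equally and turn [n!] into [n.+1!]. *)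
rewrite sumr_const cAx [in RHS]big_ord_recl mulrDr subn0 mulrCA; congr (_ + _).
rewrite factS natrM -mulrA -[LHS]mulr_natl; congr (_ * (_ * _)).
Qed.

Lemma cycle_sum_moment (T : finType) (A : {set T}) F :
  cycle_sum sigma A F = #|A|`!%:R * exp_moment a F #|A|.
Proof. by have [H _] := cycle_sum_moment_aux #|A|; exact: H. Qed.

End CycleSums.

From mathcomp Require Import ring lra.
From mathcomp Require Import all_classical all_reals all_analysis.
Import numFieldNormedType.Exports.
Local Open Scope classical_set_scope.
Local Open Scope ring_scope.

(** * Boltzmann weights as power series coefficients *)

Section Boltzmann.
Variable R : realType.

Lemma weight_prod (sigma : nat -> R) n (s : 'S_n) :
  weight sigma s = \prod_(C in porbits s) sigma #|C|.
Proof.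
(* Cycles are grouped by length, a value in ['I_n.+1]; the class of length zero is empty because
   orbits are nonempty. *)
rewrite (partition_big (fun C : {set 'I_n} => inord #|C| : 'I_n.+1) xpredT) //=.
have cardC (C : {set 'I_n}) (i : 'I_n.+1) : (inord #|C| == i) = (#|C| == i).
  have Cn : (#|C| < n.+1)%N by rewrite ltnS (leq_trans (max_card _)) ?card_ord.
  by rewrite -val_eqE /= inordK.
rewrite big_ord_recl [X in _ = X * _]big1 => [|C]; last first.
  rewrite cardC cards_eq0 => /andP[/imsetP[z _ ->]].
  by rewrite -cards_eq0 (negPf (card_porbit_neq0 _ _)).
rewrite mul1r /weight big_add1 big_mkord; apply: eq_bigr => i _.
rewrite (eq_bigr (fun=> sigma i.+1)) => [|C]; last first.
  by rewrite cardC lift0 => /andP[_ /eqP->].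
rewrite prodr_const /cyc_count; congr (_ ^+ _); apply: eq_card => C.
by rewrite inE [in RHS]unfold_in /= cardC lift0.
Qed.
(** The division by [n!] in the measure cancels the factorial in the exponential formula. *)
Lemma sum_boltz_P (sigma : nat -> R) (x : R) (F : nat -> R) n :
  \sum_(s : 'S_n) F #|porbits s| * boltz_P sigma x s
  = exp_moment (fun k => sigma k / k%:R * x ^+ k) F n / boltz_Z sigma x.
Proof.
have nf0 : n`!%:R != 0 :> R by rewrite pnatr_eq0 -lt0n fact_gt0.
rewrite exp_moment_scale; apply: (mulfI nf0).
have := cycle_sum_moment sigma [set: 'I_n] F; rewrite cardsT card_ord.
rewrite !mulrA => <-; rewrite /cycle_sum mulr_sumr !mulr_suml.
apply: eq_big => [s|s _]; first by apply/esym/fintype.subsetP=> i; rewrite inE.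
rewrite /boltz_P weight_prod /cycle_weight.
have -> : cycles_in s [set: 'I_n] = porbits s.
  by apply/setP=> C; rewrite !inE finset.subsetT andbT.
have := gt_eqF (expR_gt0 (limn (fun N => \sum_(1 <= k < N) sigma k * x ^+ k / k%:R))).
rewrite -/(boltz_Z sigma x) => /negbT; move: nf0.
move: (n`!%:R : R) (boltz_Z _ _) (\prod_(_ in _) _) (F _) (x ^+ n) => f Z w g y f0 Z0.
by field; rewrite f0 Z0.
Qed.

End Boltzmann.

(** * Series with nonnegative terms and their Cauchy products *)

Section NonnegSeries.
Variable R : realType.
Implicit Types u v : nat -> R.

Lemma nneg_series_homo u : (forall n, 0 <= u n) ->
  {homo series u : m n / (m <= n)%N >-> m <= n}.
Proof. by move=> u0 m n mn; rewrite /series /=; apply: nondecreasing_series. Qed.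

Lemma nneg_series_le_cvg u (U : R) n : (forall n, 0 <= u n) ->
  series u @ \oo --> U -> series u n <= U.
Proof.
move=> u0 uU; rewrite -(cvg_lim _ uU) //; apply: nondecreasing_cvgn_le.
  exact: nneg_series_homo.
by apply: cvgP uU.
Qed.

Lemma nneg_series_bounded_cvg u (M : R) : (forall n, 0 <= u n) ->
  (forall n, series u n <= M) ->
  exists2 U, series u @ \oo --> U & U <= M.
Proof.
move=> u0 uM.
have cu : cvgn (series u).
  apply: nondecreasing_is_cvgn; first exact: nneg_series_homo.
  by exists M => _ [n _ <-].
exists (limn (series u)) => //; apply: limr_le => //.
by apply: nearW.
Qed.

Lemma series_cauchy_prod u v n :
  series (cauchy_prod u v) n = \sum_(i < n) u i * series v (n - i)%N.
Proof.
elim: n => [|n IHn]; first by rewrite /series /= big_geq // big_ord0.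
rewrite seriesSr IHn big_ord_recr /= /cauchy_prod big_ord_recr /= subnn.
rewrite subSn // subnn addrA; congr (_ + _); last first.
  by rewrite seriesSr /series /= big_geq // add0r.
rewrite -big_split; apply: eq_bigr => i _ /=.
by rewrite subSn ?seriesSr ?mulrDr // ltnW.
Qed.

(** Partial sums of the Cauchy product run over triangles of index pairs: each is at most [U * V],
    and the triangle of side [n + n] contains the square of side [n]. *)
Lemma cvg_series_cauchy_prod u v (U V : R) :
  (forall n, 0 <= u n) -> (forall n, 0 <= v n) ->
  series u @ \oo --> U -> series v @ \oo --> V ->
  series (cauchy_prod u v) @ \oo --> U * V.
Proof.
move=> u0 v0 uU vV.
have c0 n : 0 <= cauchy_prod u v n by apply: sumr_ge0 => i _; rewrite mulr_ge0.
have U0 : 0 <= U by have := nneg_series_le_cvg 0 u0 uU; rewrite /series /= big_geq.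
have [n|L cL LUV] := @nneg_series_bounded_cvg _ (U * V) c0.
  rewrite series_cauchy_prod; apply: (@le_trans _ _ (series u n * V)).
    rewrite {2}/series /= big_mkord mulr_suml; apply: ler_sum => i _.
    by rewrite ler_wpM2l // nneg_series_le_cvg.
  by rewrite ler_wpM2r ?nneg_series_le_cvg //
     (le_trans _ (nneg_series_le_cvg 0 v0 vV)) // /series /= big_geq.
suff UVL : U * V <= L by have -> : U * V = L by apply/eqP; rewrite eq_le UVL.
apply: (cvgr_to_le (cvgM uU vV)); apply: nearW => n /=.
apply: le_trans (nneg_series_le_cvg (n + n) c0 cL).
rewrite series_cauchy_prod big_split_ord /= -[leLHS]addr0; apply: lerD; last first.
  by apply: sumr_ge0 => i _; rewrite mulr_ge0 // sumr_ge0.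
rewrite {1}/series /= big_mkord mulr_suml; apply: ler_sum => i _.
by rewrite ler_wpM2l // nneg_series_homo // -addnBA // ?leq_addr // ltnW.
Qed.

Lemma cvg_series_lin u v (U V k l : R) :
  series u @ \oo --> U -> series v @ \oo --> V ->
  series (fun n => k * u n + l * v n) @ \oo --> k * U + l * V.
Proof.
move=> uU vV.
have -> : series (fun n => k * u n + l * v n) =
    (fun n => k * series u n + l * series v n).
  by apply/funext => n; rewrite /series /= big_split !mulr_sumr.
by apply: cvgD; apply: cvgM => //; exact: cvg_cst.
Qed.

End NonnegSeries.

(** * Poisson moments as sums of power series *)

Section Moments.
Variables (R : realType) (a : nat -> R) (S : R).
Hypotheses (a0 : a 0 = 0) (a_ge0 : forall k, 0 <= a k).
Hypothesis aS : series a @ \oo --> S.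

Lemma exp_coefs_ge0 j n : 0 <= exp_coefs a j n.
Proof.
elim: j n => [|j IHj] n /=; first exact: ler0n.
by rewrite divr_ge0 // sumr_ge0 // => i _; rewrite mulr_ge0.
Qed.

Lemma exp_moment_ge0 F n : (forall j, 0 <= F j) -> 0 <= exp_moment a F n.
Proof. by move=> F0; apply: sumr_ge0 => j _; rewrite mulr_ge0 ?exp_coefs_ge0. Qed.

Lemma cvg_exp_coefs j : series (exp_coefs a j) @ \oo --> S ^+ j / j`!%:R.
Proof.
elim: j => [|j IHj].
  rewrite expr0 divr1; apply: cvg_near_cst; near=> n.
  rewrite /series /= big_ltn ?big1_seq ?addr0 //; last first.
    by near: n; exists 1%N.
  by move=> [|i] //; rewrite mem_index_iota.
have -> : series (exp_coefs a j.+1) =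
    (fun n => series (cauchy_prod a (exp_coefs a j)) n * j.+1%:R^-1).
  by apply/funext => n; rewrite /series /= mulr_suml.
have -> : S ^+ j.+1 / (j.+1)`!%:R = S * (S ^+ j / j`!%:R) * j.+1%:R^-1.
  by rewrite factS natrM invfM exprS !mulrA mulrAC.
apply: cvgM; last exact: cvg_cst.
by apply: cvg_series_cauchy_prod => // n; exact: exp_coefs_ge0.
Unshelve. all: by end_near. Qed.

Let one : nat -> R := fun=> 1.

(** The summations over [j] and [n] are exchanged by monotonicity: the rectangular sums [A J M]
    increase in both arguments, tend to partial sums of [expR S] as [M] grows, and give the partial
    sums of the left side when [J = M]. *)
Lemma cvg_exp_moment1 : series (exp_moment a one) @ \oo --> expR S.
Proof.
have one0 j : 0 <= one j by exact: ler01.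
pose A J M := \sum_(0 <= j < J) series (exp_coefs a j) M.
have AE M : series (exp_moment a one) M = A M M.
  rewrite /A /series /= exchange_big /= !big_mkord; apply: eq_bigr => n _.
  case: M n => [[]|M n] //.
  have nM : (n <= M)%N := ltn_ord n.
  rewrite (exp_moment_widen a0 _ nM) big_mkord.
  by apply: eq_bigr => j _; rewrite mul1r.
have Acvg J : A J @ \oo --> series (exp_coeff S) J.
  rewrite /A /series /=; elim: J => [|J IHJ].
    by under eq_fun do rewrite big_geq //; rewrite big_geq //; exact: cvg_cst.
  under eq_fun do rewrite big_nat_recr //=.
  by rewrite big_nat_recr //=; apply: cvgD => //; exact: cvg_exp_coefs.
have A_le J M J' M' : (J <= J')%N -> (M <= M')%N -> A J M <= A J' M'.
  move=> JJ MM; apply: (@le_trans _ _ (A J' M)).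
    apply: nondecreasing_series => // j _ _; apply: sumr_ge0 => n _.
    exact: exp_coefs_ge0.
  by apply: ler_sum => j _; apply: nneg_series_homo => // n; exact: exp_coefs_ge0.
have S0 : 0 <= S by have := nneg_series_le_cvg 0 a_ge0 aS; rewrite /series /= big_geq.
have expS : series (exp_coeff S) @ \oo --> expR S by exact: is_cvg_series_exp_coeff.
have [M|L cL LS] := @nneg_series_bounded_cvg _ (exp_moment a one) (expR S)
    (fun n => exp_moment_ge0 n one0).
  apply: le_trans (nneg_series_le_cvg M _ expS); last first.
    by move=> n; exact: exp_coeff_ge0.
  rewrite AE; apply: (cvgr_to_ge (Acvg M)); near=> M'.
  by apply: A_le => //; near: M'; exists M.
suff SL : expR S <= L by have -> : expR S = L by apply/eqP; rewrite eq_le SL.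
apply: (cvgr_to_le expS); apply: nearW => J.
apply: (cvgr_to_le (Acvg J)); near=> M.
apply: le_trans (nneg_series_le_cvg M (fun n => exp_moment_ge0 n one0) cL).
by rewrite AE; apply: A_le => //; near: M; exists J.
Unshelve. all: by end_near. Qed.

Lemma cvg_exp_moment_mean :
  series (exp_moment a (fun j => j%:R)) @ \oo --> S * expR S.
Proof.
have -> : exp_moment a (fun j => j%:R) = cauchy_prod a (exp_moment a one).
  apply/funext => n; rewrite -(exp_moment_count a0 one); apply: eq_bigr => j _.
  by rewrite mulr1.
apply: cvg_series_cauchy_prod => //; last exact: cvg_exp_moment1.
by move=> n; apply: exp_moment_ge0 => j; exact: ler01.
Qed.

(** One factor [j] of the square is absorbed into a product with [a]; the other becomes [j.+1],
    which adds the total mass to the mean. *)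
Lemma cvg_exp_moment_square :
  series (exp_moment a (fun j => j%:R ^+ 2)) @ \oo --> S * (S + 1) * expR S.
Proof.
pose h1 := exp_moment a (fun j => j.+1%:R).
have -> : exp_moment a (fun j => j%:R ^+ 2) = cauchy_prod a h1.
  by apply/funext => n; rewrite -(exp_moment_count a0 (fun j => j%:R)).
rewrite -mulrA; apply: cvg_series_cauchy_prod => //.
  by move=> n; apply: exp_moment_ge0.
have -> : h1 = fun n => 1 * exp_moment a (fun j => j%:R) n + 1 * exp_moment a one n.
  apply/funext => n; rewrite !mul1r -big_split; apply: eq_bigr => j _ /=.
  by rewrite -mulrDl -natr1.
rewrite [_ * expR S](_ : _ = 1 * (S * expR S) + 1 * expR S); last by ring.
by apply: cvg_series_lin; [exact: cvg_exp_moment_mean|exact: cvg_exp_moment1].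
Qed.

Lemma cvg_exp_moment_variance :
  series (exp_moment a (fun j => (j%:R - S) ^+ 2)) @ \oo --> S * expR S.
Proof.
have -> : exp_moment a (fun j => (j%:R - S) ^+ 2) = fun n =>
    1 * exp_moment a (fun j => j%:R ^+ 2) n
    + 1 * (- 2 * S * exp_moment a (fun j => j%:R) n
           + S ^+ 2 * exp_moment a one n).
  apply/funext => n; rewrite !mul1r /exp_moment !mulr_sumr -!big_split /=.
  by apply: eq_bigr => j _; rewrite /one; ring.
rewrite [S * _](_ : _ = 1 * (S * (S + 1) * expR S)
    + 1 * (- 2 * S * (S * expR S) + S ^+ 2 * expR S)); last by ring.
apply: cvg_series_lin; first exact: cvg_exp_moment_square.
by apply: cvg_series_lin; [exact: cvg_exp_moment_mean|exact: cvg_exp_moment1].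
Qed.

Lemma cvg_exp_moment_size (T : R) :
  series (fun k => k%:R * a k) @ \oo --> T ->
  series (fun n => n%:R * exp_moment a one n) @ \oo --> T * expR S.
Proof.
move=> bT; have -> : (fun n => n%:R * exp_moment a one n) =
    cauchy_prod (fun k => k%:R * a k) (exp_moment a one).
  by apply/funext => n; rewrite (exp_moment_size a0).
apply: cvg_series_cauchy_prod => //; last exact: cvg_exp_moment1.
  by move=> n; rewrite mulr_ge0.
by move=> n; apply: exp_moment_ge0 => j; exact: ler01.
Qed.

End Moments.

(** * Expectation and variance under the Boltzmann measure *)

Section BoltzmannMoments.
Variables (R : realType) (sigma : nat -> R) (x S T : R).
Hypotheses (sigma_ge0 : forall k, 0 <= sigma k) (x_ge0 : 0 <= x).
Let a k := sigma k / k%:R * x ^+ k.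
Hypotheses (aS : series a @ \oo --> S)
  (bT : series (fun k => k%:R * a k) @ \oo --> T).

Let a0 : a 0 = 0. Proof. by rewrite /a invr0 mulr0 mul0r. Qed.
Let a_ge0 k : 0 <= a k.
Proof. by rewrite mulr_ge0 ?exprn_ge0 // divr_ge0. Qed.

Lemma boltz_ZE : boltz_Z sigma x = expR S.
Proof.
congr expR; rewrite -[RHS](cvg_lim _ aS) //; congr (lim (_ @ \oo)).
(* The sum in [boltz_Z] starts at [1] and [series] at [0]; the extra term [a 0] is zero since the
   inverse of [0] is [0]. *)
apply/funext => -[|n]; first by rewrite /series /= !big_geq.
rewrite /series /= [RHS]big_ltn // a0 add0r; apply: eq_bigr => k _.
by rewrite mulrAC.
Qed.

Lemma boltz_E_moment F (m : R) : series (exp_moment a F) @ \oo --> m * expR S ->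
  boltz_E sigma x (fun n s => F #|porbits s|) = m.
Proof.
move=> Fm; rewrite /boltz_E; under eq_fun do under eq_bigr do rewrite sum_boltz_P.
apply: cvg_lim => //; under eq_fun do rewrite -mulr_suml boltz_ZE.
rewrite (_ : m = m * expR S / expR S); last by rewrite mulfK ?gt_eqF ?expR_gt0.
by apply: cvgM => //; exact: cvg_cst.
Qed.

Lemma boltz_E_ncycles : boltz_E sigma x (@rv_ncycles R) = S.
Proof.
exact: (boltz_E_moment (cvg_exp_moment_mean a0 a_ge0 aS)).
Qed.

Lemma boltz_V_ncycles : boltz_V sigma x (@rv_ncycles R) = S.
Proof.
rewrite /boltz_V boltz_E_ncycles.
exact: (boltz_E_moment (cvg_exp_moment_variance a0 a_ge0 aS)).
Qed.

Lemma boltz_E_size : boltz_E sigma x (@rv_size R) = T.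
Proof.
(* The size is constant on ['S_n] and leaves the inner sum, which then has test function [1]. *)
rewrite /boltz_E; under eq_fun do under eq_bigr do
  [rewrite -mulr_sumr; under eq_bigr do rewrite -[boltz_P _ _ _]mul1r;
   rewrite (sum_boltz_P _ _ (fun=> 1)) mulrA].
apply: cvg_lim => //; under eq_fun do rewrite -mulr_suml boltz_ZE.
rewrite (_ : T = T * expR S / expR S); last by rewrite mulfK ?gt_eqF ?expR_gt0.
apply: cvgM; last exact: cvg_cst.
exact: (cvg_exp_moment_size a0 a_ge0 aS bT).
Qed.

End BoltzmannMoments.

(** * Comparison of weighted series by Abel summation *)

Section AbelSummation.
Variable R : realType.
Implicit Types u v w : nat -> R.

Lemma abel_ge0 u w : (forall n, 0 <= series u n) -> (forall n, 0 <= w n) ->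
  (forall n, w n.+1 <= w n) -> forall n, 0 <= series (fun k => u k * w k) n.
Proof.
move=> u0 w0 w_dec n.
(* This stronger bound passes through the induction because [w] decreases while the partial sums of
   [u] are nonnegative. *)
suff: series u n * w n <= series (fun k => u k * w k) n.
  by apply: le_trans; rewrite mulr_ge0.
elim: n => [|n IHn]; first by rewrite /series /= !big_geq // mul0r.
rewrite [leRHS]seriesSr; apply: le_trans (lerD IHn (lexx _)).
by rewrite -mulrDl -seriesSr ler_wpM2l.
Qed.

Lemma abel_le u v w (C : R) : 0 <= C ->
  (forall n, series u n <= series v n + C) -> (forall n, 0 <= w n) ->
  (forall n, w n.+1 <= w n) ->
  forall n, series (fun k => u k * w k) n <= series (fun k => v k * w k) n + C * w 0.
Proof.
move=> C0 uv w0 w_dec n.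
(* Adding [C] to the first term only makes all partial sums of the difference nonnegative; after
   weighting it costs [C * w 0]. *)
pose d k := v k - u k + (k == 0)%:R * C.
have serd e n' : series (fun k => (v k - u k + (k == 0)%:R * C) * e k) n' =
    series (fun k => v k * e k) n' - series (fun k => u k * e k) n'
    + (0 < n')%:R * C * e 0.
  rewrite /series /=; elim: n' => [|m IHm].
    by rewrite !big_geq // mul0r mul0r subrr addr0.
  rewrite !big_nat_recr //= IHm; case: m {IHm} => [|m] /=; last by ring.
  by rewrite !big_geq //; ring.
have d0 m : 0 <= series d m.
  have := serd (fun=> 1) m.
  have E (f : nat -> R) : (fun k => f k * 1) = f by apply/funext=> k; rewrite mulr1.
  rewrite !E mulr1 => ->; case: m => [|m].
    by rewrite /series /= !big_geq // mul0r subrr addr0.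
  by rewrite mul1r; have := uv m.+1; lra.
have := abel_ge0 d0 w0 w_dec n; rewrite serd.
have : (0 < n)%:R * C * w 0 <= C * w 0.
  by case: (n) => [|m]; rewrite ?mul0r ?mul1r // mulr_ge0.
lra.
Qed.

End AbelSummation.

(** * The geometric and logarithmic series *)

Section PowerSeries.
Variable R : realType.
Implicit Types (u : nat -> R) (x : R).

Lemma cvg_seriesS u (l : R) :
  series (fun k => u k.+1) @ \oo --> l -> series u @ \oo --> u 0 + l.
Proof.
move=> ul; rewrite -cvg_shiftS.
have -> : (fun n => series u n.+1) = (fun n => u 0 + series (fun k => u k.+1) n).
  by apply/funext => n; rewrite /series /= big_ltn // big_add1.
by apply: cvgD => //; exact: cvg_cst.
Qed.

(** With all weights equal to [1] the cycle sum counts the [n!] permutations. *)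
Lemma exp_moment_harmonic n :
  exp_moment (fun k => 1 / k%:R : R) (fun=> 1) n = 1.
Proof.
have nf0 : n`!%:R != 0 :> R by rewrite pnatr_eq0 -lt0n fact_gt0.
apply: (mulfI nf0).
have := cycle_sum_moment (fun=> 1 : R) [set: 'I_n] (fun=> 1).
rewrite cardsT card_ord mulr1 => <-.
rewrite /cycle_sum (eq_bigr (fun=> 1)) => [|s _]; last first.
  by rewrite /cycle_weight big1 ?mulr1.
rewrite sumr_const -[in RHS]card_Sn; congr (_ *+ _); apply: eq_card => s.
by rewrite [in LHS]unfold_in !inE; apply/fintype.subsetP=> i; rewrite inE.
Qed.

Lemma cvg_geometricS x : 0 < x < 1 ->
  series (fun k => x ^+ k.+1) @ \oo --> x / (1 - x).
Proof.
move=> /andP[x0 x1]; have -> : (fun k => x ^+ k.+1) = geometric x x.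
  by apply/funext => k; rewrite exprS.
by apply: cvg_geometric_series; rewrite ger0_norm // ltW.
Qed.

(* For [sigma = 1] the measure is uniform on each [S_n], so its normalising
   constant [expR (\sum_k x ^+ k / k)] is the geometric series. *)
Lemma cvg_log_series x : 0 < x < 1 ->
  series (fun k => x ^+ k.+1 / k.+1%:R) @ \oo --> - ln (1 - x).
Proof.
move=> x01; have /andP[x0 x1] := x01.
pose a k := 1 / k%:R * x ^+ k : R.
have [n|n|L SL _] := @nneg_series_bounded_cvg R (fun k => x ^+ k.+1 / k.+1%:R) (x / (1 - x)).
- by rewrite divr_ge0 // exprn_ge0 // ltW.
- apply: le_trans (nneg_series_le_cvg n _ (cvg_geometricS x01)); last first.
    by move=> k; rewrite exprn_ge0 // ltW.
  apply: ler_sum => k _; rewrite ler_pdivrMr ?ltr0n //.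
  by rewrite ler_peMr ?exprn_ge0 ?ler1n // ltW.
have a0 : a 0 = 0 by rewrite /a invr0 mulr0 mul0r.
have a_ge0 k : 0 <= a k by rewrite mulr_ge0 ?divr_ge0 ?exprn_ge0 // ltW.
have aL : series a @ \oo --> L.
  rewrite -[L]add0r -a0; apply: cvg_seriesS.
  by under eq_fun do rewrite /a mulrC mul1r.
suff -> : - ln (1 - x) = L by [].
have := cvg_exp_moment1 a0 a_ge0 aL.
have -> : exp_moment a (fun=> 1) = geometric 1 x.
  apply/funext => n; rewrite (exp_moment_scale (fun k => 1 / k%:R)).
  by rewrite exp_moment_harmonic.
have xN : `|x| < 1 by rewrite ger0_norm // ltW.
move=> expL; have eL := cvg_unique _ expL (@cvg_geometric_series R 1 x xN).
by rewrite -lnV ?posrE ?subr_gt0 // -[_^-1]mul1r -eL ?expRK.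
Qed.

End PowerSeries.

(** * Bounds on both expectations from the mean of the weights *)

Section MeanWeights.
Variables (R : realType) (sigma : nat -> R) (alpha : R).
Hypotheses (sigma_ge0 : forall k, 0 <= sigma k) (alpha_gt0 : 0 < alpha).
Hypothesis mean :
  (fun n : nat => (\sum_(1 <= k < n.+1) sigma k) / n%:R) @ \oo --> alpha.

Let sigmaS k := sigma k.+1.

Lemma partial_sum_bounds (e : R) : 0 < e -> exists2 C, 0 <= C &
  forall n, (alpha - e) * n%:R - C <= series sigmaS n <= (alpha + e) * n%:R + C.
Proof.
move=> e0; have /cvgrPdist_le/(_ e e0)[N _ HN] := mean.
have s0 n : 0 <= series sigmaS n by apply: sumr_ge0 => k _; exact: sigma_ge0.
have homo := nneg_series_homo (fun k => sigma_ge0 k.+1).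
(* For [n] below the rank [N], both [series sigmaS n] and [alpha * n] are at most their values at
   [N], so this constant covers those [n]. *)
exists (series sigmaS N + alpha * N%:R).
  by rewrite addr_ge0 ?s0 // mulr_ge0 ?ler0n // ltW.
move=> n; have aN : 0 <= alpha * N%:R by rewrite mulr_ge0 ?ler0n // ltW.
have an : 0 <= alpha * n%:R by rewrite mulr_ge0 ?ler0n // ltW.
have en : 0 <= e * n%:R by rewrite mulr_ge0 ?ler0n // ltW.
have := s0 N; have := s0 n; rewrite mulrBl mulrDl => sn sN.
case: (leqP N n) => [Nn|/ltnW nN]; last first.
  have := homo _ _ nN; rewrite -/(series _ n) -/(series _ N) => hs.
  have : alpha * n%:R <= alpha * N%:R by rewrite ler_pM2l // ler_nat.
  by lra.
case: n Nn an en sn => [|n] Nn an en sn.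
  have -> : series sigmaS 0 = 0 by rewrite /series /= big_geq.
  by rewrite !mulr0; lra.
have n0 : 0 < n.+1%:R :> R by rewrite ltr0n.
have /= := HN _ Nn; rewrite ler_distlC ler_pdivlMr // ler_pdivrMr //.
rewrite big_add1 /= mulrBl mulrDl -[\sum_(0 <= i < n.+1) _]/(series sigmaS n.+1).
by lra.
Qed.

(** Abel summation against the constants [alpha - e] and [alpha + e]. The sum [U] is produced before
    [C] is quantified, so one constant can serve a whole family of weights [w]. *)
Lemma weighted_series_bounds (w : nat -> R) (W e : R) : 0 < e < alpha ->
  (forall n, 0 <= w n) -> (forall n, w n.+1 <= w n) -> series w @ \oo --> W ->
  exists2 U, series (fun k => sigmaS k * w k) @ \oo --> U &
  forall C, 0 <= C ->
  (forall n, (alpha - e) * n%:R - C <= series sigmaS n <= (alpha + e) * n%:R + C) ->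
  (alpha - e) * W - C * w 0 <= U <= (alpha + e) * W + C * w 0.
Proof.
move=> /andP[e0 ea] w0 w_dec wW.
have sercst (k : R) n : series (fun=> k) n = k * n%:R.
  by rewrite /series /= big_mkord sumr_const card_ord mulr_natr.
have serZ (k : R) n : series (fun i => k * w i) n = k * series w n.
  by rewrite /series /= mulr_sumr.
have up C : 0 <= C -> (forall n, series sigmaS n <= (alpha + e) * n%:R + C) ->
    forall n, series (fun k => sigmaS k * w k) n <= (alpha + e) * W + C * w 0.
  move=> C0 H n; have := @abel_le R sigmaS (fun=> alpha + e) w C C0 _ w0 w_dec n.
  rewrite serZ => H'; apply: le_trans (H' _) _ => [m|]; first by rewrite sercst.
  by rewrite lerD2r ler_wpM2l ?nneg_series_le_cvg //; lra.
have [C0 C0_ge0 HC0] := partial_sum_bounds e0.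
have sw0 n : 0 <= sigmaS n * w n by rewrite mulr_ge0 // sigma_ge0.
have [n|U cU _] := @nneg_series_bounded_cvg R _ ((alpha + e) * W + C0 * w 0) sw0.
  by apply: up => // m; have /andP[] := HC0 m.
exists U => // C C_ge0 HC; apply/andP; split; last first.
  apply: (cvgr_to_le cU); apply: nearW; apply: up => // m.
  by have /andP[] := HC m.
rewrite lerBlDr.
have cW : (fun n => (alpha - e) * series w n) @ \oo --> (alpha - e) * W.
  by apply: cvgM => //; exact: cvg_cst.
apply: (cvgr_to_le cW); apply: nearW => n /=.
have := @abel_le R (fun=> alpha - e) sigmaS w C C_ge0 _ w0 w_dec n.
rewrite serZ => H; apply: le_trans (H _) _ => [m|].
  by rewrite sercst -lerBlDr; have /andP[] := HC m.
by rewrite lerD2r nneg_series_le_cvg.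
Qed.

(** The weights are [x ^+ k.+1 / k.+1] for [S] and [x ^+ k.+1] for [T]. Both have [w 0 = x < 1], so
    the error [C] is uniform in [x]. *)
Lemma boltz_moments_bounds (x e : R) : 0 < e < alpha -> 0 < x < 1 ->
  let S := boltz_E sigma x (@rv_ncycles R) in
  let T := boltz_E sigma x (@rv_size R) in
  boltz_V sigma x (@rv_ncycles R) = S /\
  forall C, 0 <= C ->
  (forall n, (alpha - e) * n%:R - C <= series sigmaS n <= (alpha + e) * n%:R + C) ->
  (alpha - e) * - ln (1 - x) - C <= S <= (alpha + e) * - ln (1 - x) + C /\
  (alpha - e) * (x / (1 - x)) - C <= T <= (alpha + e) * (x / (1 - x)) + C.
Proof.
move=> he x01; have /andP[x0 x1] := x01; have x_ge0 := ltW x0.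
have xS n : x ^+ n.+1 <= x ^+ n by rewrite exprS ler_piMl ?exprn_ge0 // ltW.
have xn0 n : 0 <= x ^+ n by rewrite exprn_ge0.
have [n|n|U US HU] := weighted_series_bounds he _ _ (cvg_log_series x01).
- by rewrite divr_ge0.
- by rewrite ler_pM ?invr_ge0 ?ler0n // lef_pV2 ?posrE ?ltr0n // ler_nat.
have [//|n|V VT HV] := weighted_series_bounds he _ _ (cvg_geometricS x01).
  exact: xS.
have aS : series (fun k => sigma k / k%:R * x ^+ k) @ \oo --> U.
  rewrite -[U]add0r -[X in X + U](_ : sigma 0 / 0%:R * x ^+ 0 = 0); last first.
    by rewrite invr0 mulr0 mul0r.
  by apply: cvg_seriesS; under eq_fun do rewrite -mulrA [_^-1 * _]mulrC.
have bT : series (fun k => k%:R * (sigma k / k%:R * x ^+ k)) @ \oo --> V.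
  rewrite -[V]add0r -[X in X + V](_ : 0%:R * (sigma 0 / 0%:R * x ^+ 0) = 0); last first.
    by rewrite mul0r.
  apply: cvg_seriesS; under eq_fun do
    rewrite mulrA mulrCA divff ?pnatr_eq0 // mulr1.
  by [].
rewrite /= (boltz_E_ncycles sigma_ge0 x_ge0 aS) (boltz_V_ncycles sigma_ge0 x_ge0 aS).
rewrite (boltz_E_size sigma_ge0 x_ge0 aS bT); split=> // C C0 HC.
have Cx : C * x <= C by rewrite ler_piMr // ltW.
have /andP[U1 U2] := HU C C0 HC; have /andP[V1 V2] := HV C C0 HC.
rewrite expr1 divr1 in U1 U2; rewrite expr1 in V1 V2.
by split; apply/andP; split; lra.
Qed.

End MeanWeights.

(** * Asymptotics at the pole [x = 1] *)

Lemma cvg_ratio_pinfty (R : realType) (T : Type) (F : set_system T)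
    {FF : Filter F} (f g : T -> R) (l : R) :
  g @ F --> +oo ->
  (forall e, 0 < e -> exists C, \forall t \near F, `|f t - l * g t| <= e * g t + C) ->
  (fun t => f t / g t) @ F --> l.
Proof.
move=> goo H; apply/cvgrPdist_le => e e0.
have e2 : 0 < e / 2 by rewrite divr_gt0.
have [C HC] := H _ e2; near=> t.
have g0 : 0 < g t.
  apply: (@lt_le_trans _ _ 1) => //.
  by near: t; move/cvgryPge: goo; apply.
(* Once [g] is this large, the additive constant costs at most another [e / 2 * g t]. *)
have gC : `|C| / (e / 2) <= g t by near: t; move/cvgryPge: goo; apply.
rewrite distrC -(ler_pM2r g0) -{2}(gtr0_norm g0) -normrM mulrBl divfK ?gt_eqF //.
have : `|f t - l * g t| <= e / 2 * g t + C by near: t.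
move=> h; apply: (le_trans h).
move: gC; rewrite ler_pdivrMr // => gC; have := ler_norm C; lra.
Unshelve. all: by end_near. Qed.

Lemma log_pole_pinfty (R : realType) :
  (fun x : R => - ln (1 - x)) @ at_left (1 : R) --> +oo.
Proof.
apply/cvgryPge => A; near=> x.
have x1 : x < 1 by near: x; exact: nbhs_left_lt.
rewrite lerNr -(expRK (- A)) ler_ln ?posrE ?expR_gt0 ?subr_gt0 // ltW //.
by near: x; apply: nbhs_left_ltBl; exact: expR_gt0.
Unshelve. all: by end_near. Qed.

Unset Implicit Arguments. Set Strict Implicit. Set Printing Implicit Defensive.

Theorem theorem4p3 (R : realType) (sigma : nat -> R) (alpha : R)
  (sigma_ge0 : forall k, 0 <= sigma k)
  (alpha_gt0 : 0 < alpha)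
  (mean : (fun n : nat => (\sum_(1 <= k < n.+1) sigma k) / n%:R) @ \oo --> alpha) :
  (forall x : R, 0 < x < 1 ->
     boltz_E sigma x (@rv_ncycles R) = boltz_V sigma x (@rv_ncycles R))
  /\
  (* as x -> 1^-, with mu = E(N) *)
  ((fun x : R => boltz_E sigma x (@rv_ncycles R)
                 / (alpha * ln (boltz_E sigma x (@rv_size R))))
     @ at_left (1 : R) --> (1 : R))
  /\
  (* as mu -> oo, for x = x(mu) in (0,1) chosen with E(N) = mu *)
  (forall xmu : R -> R,
     (\forall mu \near +oo, 0 < xmu mu < 1 /\ boltz_E sigma (xmu mu) (@rv_size R) = mu) ->
     (fun mu : R => boltz_E sigma (xmu mu) (@rv_ncycles R) / (alpha * ln mu))
       @ +oo --> (1 : R)).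
Proof.
pose S x := boltz_E sigma x (@rv_ncycles R).
pose T x := boltz_E sigma x (@rv_size R).
pose L (x : R) : R := - ln (1 - x).
have bounds e : 0 < e < alpha -> exists2 C, 0 <= C & forall x, 0 < x < 1 ->
    (alpha - e) * L x - C <= S x <= (alpha + e) * L x + C /\
    (alpha - e) * (x / (1 - x)) - C <= T x <= (alpha + e) * (x / (1 - x)) + C.
  move=> he; have /andP[e0 _] := he.
  have [C C0 HC] := partial_sum_bounds sigma_ge0 alpha_gt0 mean e0.
  exists C => // x x01.
  by have [_ H] := boltz_moments_bounds sigma_ge0 alpha_gt0 mean he x01; exact: H.
(* Only the logarithm of [T] matters, so the fixed tolerance [alpha / 2] determines its growth well
   enough. *)
have half : 0 < alpha / 2 < alpha by rewrite divr_gt0 // ltr_pdivrMr //; lra.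
have [C C0 HC] := bounds _ half.
have near01 : \forall x \near (1 : R)^'-, 0 < x < 1.
  near=> x; apply/andP; split; near: x; first exact: nbhs_left_gt.
  exact: nbhs_left_lt.
have invE (x : R) : x < 1 -> x / (1 - x) = (1 - x)^-1 - 1.
  by move=> x1; field; rewrite subr_eq0 gt_eqF.
have SL : (fun x => S x / L x) @ (1 : R)^'- --> alpha.
  apply: (cvg_ratio_pinfty (@log_pole_pinfty R)) => e e0.
  (* The bounds require a tolerance below [alpha]. *)
  pose e' := Num.min e (alpha / 2).
  have he' : 0 < e' < alpha.
    by have /andP[h1 h2] := half; rewrite lt_min e0 h1 gt_min h2 orbT.
  have [C' C'0 HC'] := bounds _ he'; exists C'; near=> x.
  have x01 : 0 < x < 1 by near: x.
  have [/andP[S1 S2] _] := HC' x x01.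
  have L0 : 0 <= L x.
    by have /andP[x0 x1] := x01; rewrite /L oppr_ge0 ln_le0 // lerBlDr lerDl ltW.
  have : e' * L x <= e * L x by rewrite ler_wpM2r // ge_min lexx.
  rewrite -/(L x) ler_norml; lra.
have TL : (fun x => ln (T x) / L x) @ (1 : R)^'- --> (1 : R).
  apply: (cvg_ratio_pinfty (@log_pole_pinfty R)) => e e0.
  (* Since [1 <= (1 - x)^-1], the upper bound on [T x] is at most [K * (1 - x)^-1]. *)
  pose K := 3 * alpha / 2 + C.
  have K0 : 0 < K by rewrite /K; lra.
  have a4 : 0 < alpha / 4 by rewrite divr_gt0.
  have pos : 0 < (alpha / 2 + C) / (alpha / 4) by rewrite divr_gt0 //; lra.
  exists (`|ln K| + `|ln (alpha / 4)|); near=> x.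
  have x01 : 0 < x < 1 by near: x.
  have /andP[x0 x1] := x01.
  have [_ ] := HC x x01; rewrite invE // => /andP[T1 T2].
  have y0 : 0 < 1 - x by rewrite subr_gt0.
  have q1 : 1 <= (1 - x)^-1 by rewrite invf_ge1 // lerBlDr lerDl ltW.
  (* Beyond this threshold the lower bound [alpha / 2 * ((1 - x)^-1 - 1) - C] is at least
     [alpha / 4 * (1 - x)^-1]. *)
  have big : (alpha / 2 + C) / (alpha / 4) <= (1 - x)^-1.
    rewrite -[leLHS]invrK lef_pV2 ?posrE ?invr_gt0 // ltW //.
    by near: x; apply: nbhs_left_ltBl; rewrite invr_gt0.
  rewrite ler_pdivrMr // in big.
  have Tlo : alpha / 4 * (1 - x)^-1 <= T x by lra.
  have Thi : T x <= K * (1 - x)^-1.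
    have : C <= C * (1 - x)^-1 by rewrite ler_peMr.
    by rewrite /K; lra.
  have lo0 : 0 < alpha / 4 * (1 - x)^-1 by rewrite mulr_gt0 ?invr_gt0.
  have T0 : 0 < T x by apply: lt_le_trans Tlo.
  have Lq : ln (1 - x)^-1 = L x by rewrite lnV ?posrE.
  move: Tlo Thi; rewrite -ler_ln ?posrE // lnM ?posrE ?invr_gt0 // Lq => Tlo.
  rewrite -ler_ln ?posrE ?mulr_gt0 ?invr_gt0 // lnM ?posrE ?invr_gt0 // Lq => Thi.
  have L0 : 0 <= L x.
    by rewrite /L oppr_ge0 ln_le0 // lerBlDr lerDl ltW.
  have eL : 0 <= e * L x by rewrite mulr_ge0 // ltW.
  have := ler_norm (ln K); have := lerNnormlW (lexx `|ln (alpha / 4)|).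
  have := normr_ge0 (ln K); have := normr_ge0 (ln (alpha / 4)).
  by rewrite -/(L x) mul1r ler_norml; lra.
have lim1 : (fun x => S x / (alpha * ln (T x))) @ (1 : R)^'- --> (1 : R).
  (* The quotient is split through [L x], which is nonzero on the interval and cancels. *)
  have E : {near (1 : R)^'-, (fun x => alpha^-1 * (S x / L x) * (ln (T x) / L x)^-1)
      =1 (fun x => S x / (alpha * ln (T x)))}.
    near=> x; have x01 : 0 < x < 1 by near: x.
    have /andP[x0 x1] := x01.
    have L0 : L x != 0.
      rewrite /L oppr_eq0 ln_eq0 ?subr_gt0 //.
      by rewrite -subr_eq0 addrAC subrr sub0r oppr_eq0 gt_eqF.
    rewrite !invfM invrK; transitivity (S x * (alpha^-1 * (ln (T x))^-1) * (L x / L x)).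
      by ring.
    by rewrite divff // mulr1.
  apply: cvg_trans (near_eq_cvg E) _.
  have one : alpha^-1 * alpha * 1^-1 = 1 by rewrite mulVf ?gt_eqF // invr1 mulr1.
  rewrite -[in X in _ `=>` X]one.
  apply: cvgM; last by apply: cvgV => //; exact: oner_neq0.
  by apply: cvgM => //; exact: cvg_cst.
split; [|split] => [x x01||xmu Hx].
- by have [] := boltz_moments_bounds sigma_ge0 alpha_gt0 mean half x01.
- exact: lim1.
have xmu1 : xmu @ +oo --> (1 : R)^'-.
  move=> P [e /= e0 HP]; change (\forall mu \near +oo, P (xmu mu)); near=> mu.
  have [x01 Tmu] : 0 < xmu mu < 1 /\ T (xmu mu) = mu by near: mu; exact: Hx.
  have /andP[x0 x1] := x01.
  have y0 : 0 < 1 - xmu mu by rewrite subr_gt0.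
  apply: HP => //=; rewrite gtr0_norm //.
  have [_ /andP[_ ]] := HC _ x01; rewrite Tmu invE // => T2.
  (* The upper bound gives [mu <= 3 * alpha / 2 * ((1 - x)^-1 - 1) + C] at [x = xmu mu], so a [mu]
     above this value forces [1 - x < e]. *)
  have mu_gt : C + (3 * alpha / 2) / e < mu.
    by near: mu; apply: nbhs_pinfty_gt; exact: num_real.
  have : (3 * alpha / 2) / e < (3 * alpha / 2) / (1 - xmu mu) by lra.
  by rewrite ltr_pM2l ?ltf_pV2 ?posrE //; lra.
have E : {near +oo, (fun mu => S (xmu mu) / (alpha * ln (T (xmu mu))))
    =1 (fun mu => boltz_E sigma (xmu mu) (@rv_ncycles R) / (alpha * ln mu))}.
  near=> mu; suff -> : T (xmu mu) = mu by [].
  suff [] : 0 < xmu mu < 1 /\ T (xmu mu) = mu by [].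
  by near: mu; exact: Hx.
apply: cvg_trans (near_eq_cvg E) _.
exact: cvg_comp xmu1 lim1.
Unshelve. all: by end_near. Qed.
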